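(* Let $H,K$ be complex Hilbert spaces, let $\mathcal{A}$ be a closed complex subspace of $\mathcal{L}(H,K)$, let $C\in\mathcal{L}(K,H)$, $D\in\mathcal{L}(H)$, and let $Z_0\in\mathcal{A}$ be such that $(CZ_0+D)^{-1}$ exists. Put $X_0=(CZ_0+D)^{-1}C$ and assume that $ZX_0Z\in\mathcal{A}$ for all $Z\in\mathcal{A}$. Let $\mathcal{D}$ be the connected component containing $Z_0$ of $\{Z\in\mathcal{A}:(CZ+D)^{-1}\text{ exists}\}$. Then $\mathcal{D}$ is a symmetric affinely homogeneous domain. In particular, for each $Y\in\mathcal{D}$, the map $$U_Y(Z)=Y-(Z-Y)(CZ+D)^{-1}(CY+D)$$ is a biholomorphic mapping of $\mathcal{D}$ onto itself satisfying $U_Y\circ U_Y=\mathrm{id}$, $U_Y(Y)=Y$ and $DU_Y(Y)=-I$. Moreover, for any point $W_0\in\mathcal{D}$, there is an invertible affine linear fractional transformation $\phi$ of $\mathcal{D}$ onto itself with $\phi(Z_0)=W_0$, and $\phi$ can be chosen to be a (finite) composition of mappings $U_Y$ with $Y\in\mathcal{D}$.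
   Context: $\mathcal{L}(H,K)$ is the Banach space of bounded linear operators from $H$ to $K$ with the operator norm, and $\mathcal{L}(H)=\mathcal{L}(H,H)$. ''$(CZ+D)^{-1}$ exists'' means that $CZ+D$ is invertible in $\mathcal{L}(H)$. Holomorphic means complex Fréchet differentiable on an open set; a biholomorphic mapping is a holomorphic bijection with holomorphic inverse. $DU_Y(Y)$ denotes the Fréchet derivative of $U_Y$ at $Y$, a bounded linear operator on $\mathcal{A}$, and $I$ is the identity (here on $\mathcal{A}$). A domain is symmetric if for each of its points $Y$ there is a biholomorphic mapping $s$ of the domain onto itself with $s\circ s=\mathrm{id}$, $s(Y)=Y$ and $Ds(Y)=-I$. A domain is affinely homogeneous if for any two of its points there is an affine biholomorphic mapping of the domain onto itself taking one point to the other. An invertible affine linear fractional transformation is a map of the form $\phi(Z)=(PZ+Q)S^{-1}$ with $P\in\mathcal{L}(K)$ and $S\in\mathcal{L}(H)$ invertible and $Q\in\mathcal{L}(H,K)$. *)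

(* Defs.v *)
From HB Require Import structures.
From mathcomp Require Import all_boot all_order all_algebra.
From mathcomp Require Import complex.
From mathcomp Require Import all_classical all_reals all_analysis.

Set Implicit Arguments.
Unset Strict Implicit.
Unset Printing Implicit Defensive.

Import Order.TTheory GRing.Theory Num.Theory.
Import numFieldNormedType.Exports.

Local Open Scope classical_set_scope.
Local Open Scope ring_scope.

(* The inner product is linear in its first argument and conjugate-linear in
   the second; it is required to induce the norm. *)
HB.mixin Record NormedModule_hasInner (R : realType) H
    & NormedModule R[i] H := {
  inner : {dot H for (@Num.conj R[i])} ;
  normr_inner : forall x : H, `|x| ^+ 2 = inner x x
}.

#[short(type="hilbertType")]
HB.structure Definition Hilbert (R : realType) :=
  {H of CompleteNormedModule R[i] H & NormedModule_hasInner R H}.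

Section BoundedOperators.
Context {R : realType} {V W : normedModType R[i]}.

Definition bounded_operator : {pred V -> W} :=
  fun f => `[< linear f /\ continuous f >].

(* By linear_bounded_continuous, continuous linear maps are exactly the bounded
   ones. *)
Record blin := BLin { blin_fun :> V -> W ; _ : blin_fun \in bounded_operator }.

HB.instance Definition _ := [isSub for blin_fun].
HB.instance Definition _ := [Choice of blin by <:].

Lemma blin_linear (f : blin) : linear f.
Proof. by case: f => f /= /asboolP[]. Qed.

Lemma blin_continuous (f : blin) : continuous f.
Proof. by case: f => f /= /asboolP[]. Qed.

HB.instance Definition _ (f : blin) :=
  GRing.isLinear.Build R[i] V W *:%R (blin_fun f) (blin_linear f).

Lemma blinP (f g : blin) : f =1 g -> f = g.
Proof. by move=> fg; apply/val_inj/funext. Qed.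

Fact bounded_operator_submod : submod_closed bounded_operator.
Proof.
split.
  apply/asboolP; split; first by move=> a x y; rewrite /= scaler0 addr0.
  exact: (@cst_continuous V W 0).
move=> a f g /asboolP[lf cf] /asboolP[lg cg]; apply/asboolP; split.
  move=> b x y; rewrite !fctE /= lf lg !scalerDr !scalerA (mulrC a b).
  by rewrite !addrA; congr (_ + _); rewrite addrAC.
by move=> x; apply: cvgD; [apply: cvgZl_tmp; exact: cf|exact: cg].
Qed.

HB.instance Definition _ := GRing.isSubmodClosed.Build R[i] (V -> W)
  bounded_operator bounded_operator_submod.
HB.instance Definition _ := [SubChoice_isSubLmodule of blin by <:].

(* Norms over R[i] take their (nonnegative real) values in R[i]. *)
Definition opnorm (f : blin) : R[i] :=
  (sup [set complex.Re `|f x| | x in [set x : V | `|x| <= 1]])%:C%C.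


Lemma normRe {U : normedModType R[i]} (x : U) : `|x| = (complex.Re `|x|)%:C%C.
Proof. by rewrite RRe_real// ger0_real. Qed.

Lemma opnorm_ge0 (f : blin) : 0 <= opnorm f.
Proof.
rewrite /opnorm lecR; set S := [set _ | _ in _].
have S0 : S 0 by exists 0; rewrite /= ?linear0 normr0.
have [Ssup|/sup_out->//] := pselect (has_sup S).
exact: sup_upper_bound.
Qed.

Lemma opnorm_le (f : blin) (M : R) :
  (forall x, `|x| <= 1 -> `|f x| <= M%:C%C) -> opnorm f <= M%:C%C.
Proof.
move=> fM; rewrite lecR; apply: ge_sup.
  by exists (complex.Re `|f 0|), 0 => //=; rewrite normr0.
by move=> _ [x /= x1 <-]; rewrite -lecR -normRe fM.
Qed.

Lemma opnorm_ub (f : blin) (x : V) : `|f x| <= opnorm f * `|x|.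
Proof.
have fub : has_ubound [set complex.Re `|f x| | x in [set x : V | `|x| <= 1]].
  have /(_ 0)/continuous_linear_bounded := @blin_continuous f.
  move=> /(_ 0)/bounded_funP/(_ 1)[M fM].
  exists (complex.Re M) => _ [y /= /fM fyM <-].
  by move: fyM; rewrite lecE => /andP[].
have [->|x0] := eqVneq x 0; first by rewrite linear0 !normr0 mulr0.
have nx0 : 0 < `|x| by rewrite normr_gt0.
rewrite -ler_pdivrMr// mulrC.
have -> : `|x|^-1 * `|f x| = `|f (`|x|^-1 *: x)|.
  by rewrite linearZ/= normrZ normfV normr_id.
rewrite normRe lecR; apply: sup_upper_bound.
  by split=> //; exists (complex.Re `|f 0|), 0 => //=; rewrite normr0.
by exists (`|x|^-1 *: x) => //=; rewrite normrZ normfV normr_id mulVf// gt_eqF.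
Qed.

Lemma opnormRe (f : blin) : opnorm f = (complex.Re (opnorm f))%:C%C.
Proof. by []. Qed.

Fact opnormD (f g : blin) : opnorm (f + g) <= opnorm f + opnorm g.
Proof.
rewrite (opnormRe f) (opnormRe g) -rmorphD/=; apply: opnorm_le => x x1.
rewrite (le_trans (ler_normD _ _))// rmorphD/= -!opnormRe.
have h1 (h : blin) : `|h x| <= opnorm h.
  rewrite (le_trans (opnorm_ub h x))// -[leRHS]mulr1 ler_wpM2l//.
  exact: opnorm_ge0.
by rewrite lerD.
Qed.

Fact opnormZ (l : R[i]) (f : blin) : opnorm (l *: f) = `|l| * opnorm f.
Proof.
have le1 k (g : blin) : opnorm (k *: g) <= `|k| * opnorm g.
  rewrite (@normRe (R[i])^o k) (opnormRe g) -rmorphM/=; apply: opnorm_le => x x1.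
  rewrite rmorphM/= -(@normRe (R[i])^o k) -(opnormRe g) normrZ ler_wpM2l//.
  rewrite (le_trans (opnorm_ub g x))// -[leRHS]mulr1 ler_wpM2l//.
  exact: opnorm_ge0.
have [->|l0] := eqVneq l 0.
  apply/le_anti/andP; split; first exact: le1.
  by rewrite normr0 mul0r opnorm_ge0.
apply/le_anti; rewrite le1/= -ler_pdivlMl ?normr_gt0// -normfV.
by rewrite -{1}(scalerK l0 f) le1.
Qed.

Fact opnorm0_eq0 (f : blin) : opnorm f = 0 -> f = 0.
Proof.
move=> f0; apply: blinP => x; apply/eqP; rewrite -normr_le0.
by rewrite (le_trans (opnorm_ub f x))// f0 mul0r.
Qed.

HB.instance Definition _ :=
  Lmodule_isNormed.Build R[i] blin opnormD opnormZ opnorm0_eq0.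

End BoundedOperators.

Arguments blin {R} V W.

Notation "''L(' V , W )" := (blin V W) (format "''L(' V ,  W )").

Section OperatorAlgebra.
Context {R : realType}.
Implicit Types U V W : normedModType R[i].

Fact bcomp_subproof U V W (S : 'L(V, W)) (T : 'L(U, V)) :
  (S \o T : U -> W) \in bounded_operator.
Proof.
apply/asboolP; split; first by move=> a x y /=; rewrite !linearP.
by move=> x; apply: continuous_comp; apply: blin_continuous.
Qed.

Definition bcomp U V W (S : 'L(V, W)) (T : 'L(U, V)) : 'L(U, W) :=
  BLin (bcomp_subproof S T).

Fact bid_subproof V : (@idfun V) \in bounded_operator.
Proof. by apply/asboolP; split=> // x; exact: cvg_id. Qed.

Definition bid V : 'L(V, V) := BLin (bid_subproof V).

Definition is_binv V W (T : 'L(V, W)) (S : 'L(W, V)) :=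
  bcomp S T = bid V /\ bcomp T S = bid W.

Definition binvertible V W (T : 'L(V, W)) := exists S, is_binv T S.

(* the two-sided bounded inverse of T, and 0 if T is not invertible *)
Definition binv V W (T : 'L(V, W)) : 'L(W, V) := xget 0 [set S | is_binv T S].

End OperatorAlgebra.

Arguments bid {R} V.

Notation "S \oL T" := (bcomp S T) (at level 40, left associativity).
Notation "T ^-L" := (binv T) (at level 3, left associativity, format "T ^-L").

(* A closed subspace A coerces to the type of its elements, which carries the
   norm and topology induced by V. *)
Record closedSubspace (R : realType) (V : normedModType R[i]) := ClosedSubspace {
  subspace_set : set V ;
  subspace_submod : submod_closed (mem subspace_set) ;
  subspace_closed : closed subspace_set
}.

Section ClosedSubspaceType.
Context {R : realType} {V : normedModType R[i]} (A : closedSubspace V).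

Definition subspace_mem : {pred V} := mem (subspace_set A).

Record subspace_elt := SubspaceElt {
  subspace_val : V ;
  _ : subspace_val \in subspace_mem
}.

HB.instance Definition _ := [isSub for subspace_val].
HB.instance Definition _ := [Choice of subspace_elt by <:].
HB.instance Definition _ := GRing.isSubmodClosed.Build R[i] V
  subspace_mem (subspace_submod A).
HB.instance Definition _ := [SubChoice_isSubLmodule of subspace_elt by <:].

Definition subspace_norm (u : subspace_elt) : R[i] := `|subspace_val u|.

Fact subspace_normD u v :
  subspace_norm (u + v) <= subspace_norm u + subspace_norm v.
Proof. exact: ler_normD. Qed.

Fact subspace_normZ (l : R[i]) u :
  subspace_norm (l *: u) = `|l| * subspace_norm u.
Proof. exact: normrZ. Qed.

Fact subspace_norm0_eq0 u : subspace_norm u = 0 -> u = 0.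
Proof. by move=> /normr0_eq0 u0; apply: val_inj. Qed.

HB.instance Definition _ := Lmodule_isNormed.Build R[i] subspace_elt
  subspace_normD subspace_normZ subspace_norm0_eq0.

(* corestr f u is f u seen as an element of A, and 0 if f u is not in A; any
   statement using it must separately assert that f u is in A. *)
Definition corestr (f : V -> V) (u : subspace_elt) : subspace_elt :=
  insubd 0 (f (subspace_val u)).

End ClosedSubspaceType.

Coercion subspace_elt : closedSubspace >-> Sortclass.

Section Domains.
Context {R : realType}.
Implicit Types V W : normedModType R[i].

Definition domain V (D : set V) := [/\ D !=set0, open D & connected D].

(* Functions are total; differentiable f x only depends on f near x, hence, as D
   is open, only on the values of f on D. Differentiability is over R[i]. *)
Definition holomorphic V W (D : set V) (f : V -> W) :=
  open D /\ forall x, D x -> differentiable f x.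

Definition biholomorphic V W (D : set V) (E : set W) (f : V -> W) :=
  [/\ holomorphic D f, set_bij D E f &
      exists2 g : W -> V, {in D, cancel f g} & holomorphic E g].

Definition symmetry_at V (D : set V) (Y : V) (s : V -> V) :=
  [/\ biholomorphic D D s, {in D, cancel s s}, s Y = Y &
      forall h, 'd s Y h = - h].

Definition symmetric_domain V (D : set V) :=
  domain D /\ forall Y, D Y -> exists s, symmetry_at D Y s.

Definition affine_map V W (f : V -> W) :=
  exists (T : 'L(V, W)) (b : W), forall x, f x = T x + b.

Definition affinely_homogeneous V (D : set V) :=
  forall x y, D x -> D y ->
    exists g, [/\ affine_map g, biholomorphic D D g & g x = y].

End Domains.

Section LinearFractional.
Context {R : realType} {H K : hilbertType R} (A : closedSubspace 'L(H, K)).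

Definition lft_domain (C : 'L(K, H)) (D : 'L(H, H)) : set A :=
  [set Z | binvertible (C \oL \val Z + D)].

Definition U_formula (C : 'L(K, H)) (D : 'L(H, H)) (Y Z : 'L(H, K)) :
  'L(H, K) := Y - (Z - Y) \oL (C \oL Z + D)^-L \oL (C \oL Y + D).

Definition U_map (C : 'L(K, H)) (D : 'L(H, H)) (Y : A) : A -> A :=
  corestr (U_formula C D (\val Y)).

Definition invertible_affine_lft (phi : A -> A) :=
  exists (P : 'L(K, K)) (Q : 'L(H, K)) (S : 'L(H, H)),
    [/\ binvertible P, binvertible S &
        forall Z : A, \val (phi Z) = (P \oL \val Z + Q) \oL S^-L].

End LinearFractional.

(* Main.v *)
Require Import Defs.
From HB Require Import structures.
From mathcomp Require Import all_boot all_order all_algebra.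
From mathcomp Require Import complex.
From mathcomp Require Import ring lra.
From mathcomp Require Import all_classical all_reals all_analysis.

Set Implicit Arguments.
Unset Strict Implicit.
Unset Printing Implicit Defensive.

Import Order.TTheory GRing.Theory Num.Theory.
Import numFieldNormedType.Exports.

Local Open Scope classical_set_scope.
Local Open Scope ring_scope.

(** Write M(Z) = C Z + D and X(Z) = M(Z)^-1 C, so that the hypothesis says that
    Z X(Z0) Z lies in A for all Z in A. Call an operator X with this property
    Jordan-closed: the symmetrized product Z X W + W X Z then makes A a Jordan
    algebra, and A is also stable under Z X W X Z.

    The symmetry U_Y is described by three identities. First, M(U_Y(Z)) =
    M(Y) M(Z)^-1 M(Y) (lft_den_sym), so U_Y preserves invertibility of M and
    U_Y o U_Y = id (lft_symK). Secondly, with T = Z - Y,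
    U_Y(Z) = Y - T + T X(Z) T (lft_symE), so U_Y(Z) lies in A as soon as X(Z) is
    Jordan-closed, and the differential of U_Y at Y is -I because the last term
    is of second order. Thirdly, U_Y2 o U_Y1 is affine (lft_sym_comp).

    The Jordan property is known at Z0 only. It spreads to the whole component:
    X(Z) = X(Y) - X(Y) (Z - Y) X(Z), and solving this equation for X(Z) by a
    contraction inside the closed subspace A shows that X(Y) is Jordan-closed if
    and only if X(Z) is, for Z near Y (jordan_closed_near). A property that is
    locally constant on a connected set and holds at one point holds everywhere
    (connected_locally_const).

    Affinity of the products also gives holomorphy: near a point Z, the map U_Y
    equals (U_Y o U_Z) o U_Z, an affine map after a map which is differentiable
    at its own centre Z. As U_Y fixes Y and is continuous, it maps the
    component into itself.

    For transitivity, two points W, Z close to each other have a midpoint Y,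
    with U_Y(Z) = W: putting Y = Z + V, this is the quadratic equation
    2 V + V X(Z) V = W - Z, solved in A by a contraction (midpoint_equation).
    Then the affine map U_Y o U_Z takes Z to W. Hence being the image of a given
    point under a product of an even number of symmetries is again a locally
    constant property, and connected_locally_const concludes once more. *)

(** * Bounded operators *)

Section OperatorCalculus.
Context {R : realType}.
Implicit Types U V W X : normedModType R[i].

Lemma bcompA U V W X (S : 'L(W, X)) (T : 'L(V, W)) (P : 'L(U, V)) :
  S \oL (T \oL P) = S \oL T \oL P.
Proof. exact: blinP. Qed.

Lemma bcomp1l V W (S : 'L(V, W)) : bid W \oL S = S.
Proof. exact: blinP. Qed.

Lemma bcomp1r V W (S : 'L(V, W)) : S \oL bid V = S.
Proof. exact: blinP. Qed.

Lemma bcompDl U V W (S T : 'L(V, W)) (P : 'L(U, V)) :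
  (S + T) \oL P = S \oL P + T \oL P.
Proof. exact: blinP. Qed.

Lemma bcompNl U V W (S : 'L(V, W)) (P : 'L(U, V)) :
  (- S) \oL P = - (S \oL P).
Proof. exact: blinP. Qed.

Lemma bcompBl U V W (S T : 'L(V, W)) (P : 'L(U, V)) :
  (S - T) \oL P = S \oL P - T \oL P.
Proof. exact: blinP. Qed.

Lemma bcompZl U V W (k : R[i]) (S : 'L(V, W)) (P : 'L(U, V)) :
  (k *: S) \oL P = k *: (S \oL P).
Proof. exact: blinP. Qed.

Lemma bcompDr U V W (S : 'L(V, W)) (P Q : 'L(U, V)) :
  S \oL (P + Q) = S \oL P + S \oL Q.
Proof. by apply: blinP => x; exact: linearD. Qed.

Lemma bcompNr U V W (S : 'L(V, W)) (P : 'L(U, V)) :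
  S \oL (- P) = - (S \oL P).
Proof. by apply: blinP => x; exact: linearN. Qed.

Lemma bcompBr U V W (S : 'L(V, W)) (P Q : 'L(U, V)) :
  S \oL (P - Q) = S \oL P - S \oL Q.
Proof. by rewrite bcompDr bcompNr. Qed.

Lemma bcompZr U V W (k : R[i]) (S : 'L(V, W)) (P : 'L(U, V)) :
  S \oL (k *: P) = k *: (S \oL P).
Proof. by apply: blinP => x; exact: linearZ. Qed.

Lemma bcomp0r U V W (S : 'L(V, W)) : S \oL (0 : 'L(U, V)) = 0.
Proof. by apply: blinP => x; exact: linear0. Qed.

Lemma bcomp0l U V W (P : 'L(U, V)) : (0 : 'L(V, W)) \oL P = 0.
Proof. exact: blinP. Qed.

Lemma blin_norm_ub V W (f : 'L(V, W)) x : `|f x| <= `|f| * `|x|.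
Proof. exact: opnorm_ub. Qed.

Lemma blin_norm_le V W (f : 'L(V, W)) (M : R[i]) :
  0 <= M -> (forall x, `|f x| <= M * `|x|) -> `|f| <= M.
Proof.
move=> M0 fM; rewrite -(RRe_real (ger0_real M0)); apply: opnorm_le => x x1.
rewrite (RRe_real (ger0_real M0)) (le_trans (fM x))//.
by rewrite -[leRHS]mulr1 ler_wpM2l.
Qed.

Lemma bcomp_norm U V W (S : 'L(V, W)) (T : 'L(U, V)) :
  `|S \oL T| <= `|S| * `|T|.
Proof.
apply: blin_norm_le => [|x]; first by rewrite mulr_ge0.
rewrite (le_trans (blin_norm_ub S (T x)))// -mulrA ler_wpM2l//.
exact: blin_norm_ub.
Qed.

Lemma linear_bounded_operator V W (f : V -> W) (M : R[i]) :
  0 <= M -> linear f -> (forall x, `|f x| <= M * `|x|) ->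
  f \in bounded_operator.
Proof.
move=> M0 lf fM; apply/asboolP; split=> //.
pose F : {linear V -> W} :=
  HB.pack f (GRing.isLinear.Build R[i] V W *:%R f lf).
apply: (@bounded_linear_continuous _ _ _ F); apply/linear_boundedP.
near=> r => x; rewrite (le_trans (fM x))// ler_wpM2r//.
by near: r; apply: nbhs_pinfty_ge; exact: ger0_real.
Unshelve. all: by end_near. Qed.

End OperatorCalculus.

(** * Completeness and fixed points *)

Section Completeness.
Context {R : realType} {V : normedModType R[i]}.
Context {W : completeNormedModType R[i]}.

(** A Cauchy filter of operators converges pointwise because W is complete; the
    Cauchy condition is uniform on the unit ball, so the pointwise limit is
    bounded and is a limit in norm. *)
Lemma blin_complete (F : set_system 'L(V, W)) :
  ProperFilter F -> cauchy F -> cvg F.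
Proof.
move=> FF /cauchy_ballP Fc.
have Fe (e : R[i]) : 0 < e -> \forall f & g \near F,
    forall x : V, `|blin_fun f x - blin_fun g x| <= e * `|x|.
  move=> e0; have := Fc e e0; rewrite -ball_normE/=.
  apply: filterS => -[f g] /= fg x.
  by rewrite (le_trans (blin_norm_ub (f - g) x))// ler_wpM2r// ltW.
have cF x : cvg ((fun f : 'L(V, W) => f x) @ F).
  apply/cauchy_cvgP/cauchy_ballP => e e0.
  have x1 : 0 < `|x| + 1 by rewrite ltr_wpDl.
  rewrite near_map2; have := Fe _ (divr_gt0 e0 x1).
  apply: filterS => -[f g] /= /(_ x) fg.
  rewrite -ball_normE/= (le_lt_trans fg)// mulrAC ltr_pdivrMr// ltr_pM2l//.
  by rewrite ltrDl.
pose l x := lim ((fun f : 'L(V, W) => f x) @ F).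
have lin : linear l.
  move=> a x y; apply: cvg_lim => //.
  under eq_fun do rewrite linearP.
  by apply: cvgD; [apply: cvgZl_tmp|]; exact: cF.
(* Convergence is uniform: the operator g used to compare l and f may depend on
   x, but the final estimate does not. *)
have lF (e : R[i]) : 0 < e ->
    \forall f \near F, forall x : V, `|l x - blin_fun f x| <= e * `|x|.
  move=> e0; have e2 : 0 < e / 2 by rewrite divr_gt0.
  near=> f => x; have [->|x0] := eqVneq x 0.
    have -> : l 0 = 0.
      by apply: cvg_lim => //; under eq_fun do rewrite linear0; exact: cvg_cst.
    by rewrite linear0 subrr !normr0 mulr0.
  near F => g.
  rewrite -(subrKA (g x)) (le_trans (ler_normD _ _))// (splitr e) mulrDl lerD//.
    near: g; apply: cvgr_dist_le; first exact: cF.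
    by rewrite mulr_gt0// normr_gt0.
  rewrite distrC; move: (x); near: g; near: f; apply: nearP_dep.
  exact: Fe.
have [f0 lf0] : exists f : 'L(V, W), forall x, `|l x - f x| <= 1 * `|x|.
  exact: filter_ex (lF 1 ltr01).
have lb : l \in bounded_operator.
  apply: (@linear_bounded_operator _ _ _ _ (1 + `|f0|)) => // x.
  rewrite -(subrK (f0 x) (l x)) (le_trans (ler_normD _ _))// mulrDl lerD//.
  exact: blin_norm_ub.
apply/cvg_ex; exists (BLin lb); apply/cvgrPdist_le => e e0.
near=> f; apply: blin_norm_le; first exact: ltW.
by near: f; exact: lF.
Unshelve. all: by end_near. Qed.

HB.instance Definition _ := Uniform_isComplete.Build 'L(V, W) blin_complete.
End Completeness.

(** The contraction principle for norms with values in the partially ordered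
    field R[i]; the ratio is taken in R, where its powers are known to tend to
    zero. *)
Theorem contraction_fixpoint (R : realType) (V : completeNormedModType R[i])
    (S : set V) (f : V -> V) (q : R) :
  closed S -> S !=set0 -> 0 <= q -> q < 1 -> (forall x, S x -> S (f x)) ->
  (forall x y, S x -> S y -> `|f x - f y| <= q%:C%C * `|x - y|) ->
  exists2 p, S p & f p = p.
Proof.
move=> clS [x0 Sx0] q0 q1 fS ctr; pose y n := iter n f x0.
have Sy n : S (y n) by elim: n => //= n; exact: fS.
have q0' : 0 <= q%:C%C by rewrite lecR.
have q1' : 0 < 1 - q%:C%C by rewrite subr_gt0 ltcR.
pose c := `|x0 - f x0| / (1 - q%:C%C).
have c0 : 0 <= c by rewrite divr_ge0// ltW.
have dist0 m : `|x0 - y m| <= c.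
  elim: m => [|m IH]; first by rewrite subrr normr0.
  rewrite -(subrKA (f x0)) (le_trans (ler_normD _ _))//.
  have -> : c = `|x0 - f x0| + q%:C%C * c.
    rewrite /c; field.
    by rewrite gt_eqF.
  by rewrite lerD// (le_trans (ctr _ _ Sx0 (Sy m)))// ler_wpM2l.
have dist n m : `|y n - y (n + m)%N| <= q%:C%C ^+ n * c.
  elim: n => [|n IH]; first by rewrite mul1r.
  by rewrite addSn exprS -mulrA (le_trans (ctr _ _ (Sy _) (Sy _)))// ler_wpM2l.
have cy : cvg (y @ \oo).
  apply/cauchy_cvgP/cauchy_exP => e e0.
  have [N Nq] : exists N, q%:C%C ^+ N * c < e.
    have cR : c = (complex.Re c)%:C%C by rewrite RRe_real// ger0_real.
    have eR : e = (complex.Re e)%:C%C by rewrite RRe_real// gtr0_real.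
    have rc0 : 0 <= complex.Re c by rewrite -lecR -cR.
    have d0 : 0 < complex.Re e / (complex.Re c + 1).
      by rewrite divr_gt0// ?ltr_wpDl// -ltcR -eR.
    have /cvgrPdist_lt/(_ _ d0)[N _ /(_ N (leqnn N))] :
        geometric 1 q @ \oo --> 0.
      by apply: cvg_geometric; rewrite ger0_norm.
    rewrite /= sub0r normrN mul1r ger0_norm ?exprn_ge0// => qN; exists N.
    rewrite cR eR -rmorphXn -rmorphM ltcR/=.
    rewrite (le_lt_trans _ (_ : q ^+ N * (complex.Re c + 1) < _))//.
      by rewrite ler_wpM2l ?exprn_ge0// lerDl.
    by rewrite -ltr_pdivlMr// ltr_wpDl.
  exists (y N); exists N => // m /= Nm.
  rewrite -ball_normE/= -(subnKC Nm); exact: le_lt_trans (dist _ _) Nq.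
have Sl : S (lim (y @ \oo)).
  by apply: closed_cvg cy => //; exact: nearW.
exists (lim (y @ \oo)) => //.
apply/esym/cvg_lim => //.
rewrite -(cvg_shiftS y)/=.
apply/cvgrPdist_lt => e e0; near=> n.
rewrite (le_lt_trans (ctr _ _ Sl (Sy n)))//.
rewrite (@le_lt_trans _ _ (1 * `|lim (y @ \oo) - y n|))//.
  by rewrite ler_wpM2r// lecR ltW.
rewrite mul1r; near: n; exact: cvgr_dist_lt.
Unshelve. all: by end_near. Qed.

Lemma closed_norm_le (R : realType) (V : normedModType R[i]) (r : R[i]) :
  closed [set x : V | `|x| <= r].
Proof.
move=> x cx; apply/ler_addgt0Pr => e e0.
have [y [/= yr]] := cx _ (nbhsx_ballx x e e0).
rewrite -ball_normE/= => /ltW xy.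
by rewrite -(subrK y x) addrC (le_trans (ler_normD _ _))// lerD.
Qed.

(** * Connected sets in normed modules *)

Section Connectedness.

(** The points of S where P holds form a subset that is both open and closed
    in S. *)
Lemma connected_locally_const (T : topologicalType) (S : set T)
    (P : T -> Prop) (x0 : T) :
  connected S -> S x0 -> P x0 ->
  (forall x, S x -> \forall y \near x, S y -> (P x <-> P y)) ->
  forall x, S x -> P x.
Proof.
move=> cS Sx0 Px0 locP x Sx.
suff SP : S `&` [set y | P y] = S by move: Sx; rewrite -SP => -[].
apply: cS; first by exists x0.
  exists (interior [set y | S y -> P y]); first exact: open_interior.
  apply/seteqP; split=> y [Sy] /=; last first.
    by move=> /nbhs_singleton Py; split; auto.
  move=> Py; split=> //; have := locP y Sy; apply: filterS => z Pyz /Pyz.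
  by case=> + _; apply.
exists (closure (S `&` [set y | P y])); first exact: closed_closure.
apply/seteqP; split=> y.
  by move=> SPy; split; [case: SPy|exact: subset_closure].
move=> [Sy cly]; split=> //; have [z [[Sz Pz] /(_ Sz)]] := cly _ (locP y Sy).
by move=> h; exact/h.
Qed.

(** A ball is the union of the segments that join its points to its centre. *)
Lemma ball_connected (R : realType) (V : normedModType R[i]) (x : V)
    (e : R[i]) :
  connected (ball x e).
Proof.
pose seg (y : V) (t : R) := x + t%:C%C *: (y - x).
have cseg y : continuous (seg y).
  move=> t; apply/cvgrPdist_lt => d d0.
  have dR : d = (complex.Re d)%:C%C by rewrite RRe_real// gtr0_real.
  have nR := normRe (y - x).
  have n0 : 0 <= complex.Re `|y - x| by rewrite -lecR -nR normr_ge0.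
  have d1 : 0 < complex.Re d / (complex.Re `|y - x| + 1).
    by rewrite divr_gt0// ?ltr_wpDl// -ltcR -dR.
  near=> s.
  rewrite /seg opprD addrACA subrr add0r -scalerBl -rmorphB normrZ nR dR.
  have -> : `|(t - s)%:C%C : R[i]| = `|t - s|%:C%C.
    by rewrite normc_def/= expr0n addr0 sqrtr_sqr.
  rewrite -rmorphM ltcR.
  rewrite (le_lt_trans (_ : _ <= `|t - s| * (complex.Re `|y - x| + 1)))//.
    by rewrite ler_wpM2l// lerDl.
  rewrite -ltr_pdivlMr ?ltr_wpDl//; near: s.
have [e0|/negP e0] := boolP (0 < e); last first.
  rewrite (_ : ball x e = set0); first exact: connected0.
  rewrite -subset0 => y; rewrite -ball_normE/= => /(le_lt_trans (normr_ge0 _)).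
  by move=> /e0.
have -> : ball x e = \bigcup_(y in ball x e) (seg y @` `[0, 1]).
  apply/seteqP; split=> [y xy|z [y xy [t /= t01 <-]]].
    exists y => //; exists 1; rewrite /= ?in_itv/= ?lexx ?ler01//.
    by rewrite /seg scale1r addrC subrK.
  move: xy t01; rewrite -ball_normE/= in_itv/= => xy /andP[t0 t1].
  rewrite /seg opprD addrA subrr sub0r normrN normrZ ger0_norm ?lecR//.
  rewrite distrC in xy; rewrite (le_lt_trans _ xy)// ler_piMl//.
  by rewrite lecR.
apply: bigcup_connected.
  exists x => y _; exists 0; rewrite /= ?in_itv/= ?lexx ?ler01//.
  by rewrite /seg scale0r addr0.
move=> y _; apply: connected_continuous_connected.
  exact: segment_connected.
exact/continuous_subspaceT.
Unshelve. all: by end_near. Qed.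

(** Components of open sets are open because balls are connected. *)
Lemma connected_component_open (R : realType) (V : normedModType R[i])
    (S : set V) (x : V) : open S -> open (connected_component S x).
Proof.
move=> oS; rewrite openE => y Cy.
have Sy := connected_component_sub Cy.
have /nbhs_ballP[e /= e0 eS] : nbhs y S by exact: open_nbhs_nbhs.
apply/nbhs_ballP; exists e => //= z yz.
apply: connected_component_trans Cy _.
apply: (connected_component_max _ eS) => //; first exact: ballxx.
exact: ball_connected.
Qed.

End Connectedness.

(** * Differentials and biholomorphic maps *)

Section Differentiability.
Context {R : realType}.
Implicit Types U V W : normedModType R[i].

(** An explicit second-order remainder avoids computing with Landau symbols in
    spaces of operators. *)
Lemma quadratic_remainder_diff V W (f : V -> W) (x : V) (L : 'L(V, W))
    (k : R[i]) :
  0 <= k -> (\forall h \near 0, `|f (x + h) - f x - L h| <= k * `|h| ^+ 2) ->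
  differentiable f x /\ 'd f x = L :> (V -> W).
Proof.
move=> k0 fL.
have fE : f \o shift x = cst (f x) + L +o_ 0 id.
  apply/eqaddoP => e e0; near=> h.
  have -> : (f \o shift x - (cst (f x) + L)) h = f (x + h) - f x - L h.
    by rewrite !fctE/= opprD addrA (addrC h).
  have /le_trans -> // : `|f (x + h) - f x - L h| <= k * `|h| ^+ 2.
    by near: h.
  rewrite expr2 mulrA ler_wpM2r//.
  have hk : `|h| <= e / (k + 1).
    near: h; apply: cvgr0_norm_le => //.
    by rewrite divr_gt0// ltr_wpDl.
  rewrite (le_trans (ler_wpM2l k0 hk))// mulrCA ler_piMr// ?(ltW e0)//.
  by rewrite ler_pdivrMr ?ltr_wpDl// mul1r lerDl.
have dL : 'd f x = L :> (V -> W).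
  by apply: diff_unique => //; exact: blin_continuous.
split=> //; apply/diff_locallyP; rewrite dL; split=> //; exact: blin_continuous.
Unshelve. all: by end_near. Qed.

Lemma affine_map_differentiable V W (f : V -> W) x :
  affine_map f -> differentiable f x.
Proof.
move=> [T [b fE]].
apply: (proj1 (@quadratic_remainder_diff _ _ f x T 0 _ _)) => //.
near=> h; rewrite !fE linearD mul0r.
by rewrite (addrAC (T x)) (addrC _ (T h)) addrK subrr normr0.
Unshelve. all: by end_near. Qed.

Lemma near_eq_differentiable V W (f g : V -> W) x :
  (\forall y \near x, f y = g y) -> differentiable g x -> differentiable f x.
Proof.
move=> fg dg; have fgx := nbhs_singleton fg.
have /diff_locallyP[dc dE] := dg.
have fE : f \o shift x = cst (f x) + 'd g x +o_ 0 id.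
  rewrite fgx; move/eqaddoP: dE => dE; apply/eqaddoP => e e0.
  have fg0 : \forall h \near 0, f (h + x) = g (h + x).
    by move: fg; rewrite (near_shift 0) subr0.
  near=> h.
  suff -> : (f \o shift x - (cst (g x) + 'd g x)) h =
            (g \o shift x - (cst (g x) + 'd g x)) h by near: h; exact: dE.
  rewrite !fctE/=; congr (_ - _).
  by near: h.
by apply/diff_locallyP; rewrite (diff_unique dc fE).
Unshelve. all: by end_near. Qed.

Lemma biholomorphic_comp V (D : set V) (f g : V -> V) :
  biholomorphic D D f -> biholomorphic D D g -> biholomorphic D D (g \o f).
Proof.
move=> [[oD df] bf [f' ff' [_ df']]] [[_ dg] bg [g' gg' [_ dg']]].
have Df x : D x -> D (f x) by case: bf => + _ _ => /[apply].
have Dg x : D x -> D (g x) by case: bg => + _ _ => /[apply].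
have Dg' y : D y -> D (g' y).
  case: bg => _ _ sg Dy; have [x Dx <-] := sg y Dy.
  by rewrite gg' ?inE.
split.
- split=> // x Dx; apply: differentiable_comp; first exact: df.
  by apply: dg; exact: Df.
- exact: set_bij_comp bf bg.
- exists (f' \o g').
    move=> x /[!inE] Dx /=; rewrite gg' ?inE; last exact: Df.
    by rewrite ff' ?inE.
  split=> // x Dx; apply: differentiable_comp; first exact: dg'.
  by apply: df'; exact: Dg'.
Qed.

Lemma biholomorphic_eq V (D : set V) (f g : V -> V) :
  {in D, f =1 g} -> biholomorphic D D g -> biholomorphic D D f.
Proof.
move=> fg [[oD dg] bg [g' gg' hg']].
split; last by exists g' => // x xD; rewrite fg// gg'.
- split=> // x Dx; apply: near_eq_differentiable (dg x Dx).
  near=> y; apply: fg; rewrite inE; near: y; exact: open_nbhs_nbhs.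
- exact: eq_set_bijLR fg bg.
Unshelve. all: by end_near. Qed.

Lemma involution_biholomorphic V (D : set V) (f : V -> V) :
  holomorphic D f -> (forall x, D x -> D (f x)) -> {in D, cancel f f} ->
  biholomorphic D D f.
Proof.
move=> hf Df ff; split=> //; last by exists f.
split=> //.
- by move=> x y xD yD fxy; rewrite -(ff x)// fxy ff.
- by move=> y Dy; exists (f y); [exact: Df|rewrite ff ?inE].
Qed.

End Differentiability.

(** * Inverses *)

Section Inverses.
Context {R : realType}.
Implicit Types U V W : normedModType R[i].

Lemma binv_is_binv V W (T : 'L(V, W)) : binvertible T -> is_binv T T^-L.
Proof.
by move=> [S TS]; apply: (@xgetPex _ _ [set S | is_binv T S]); exists S.
Qed.

Lemma bcompVl V W (T : 'L(V, W)) : binvertible T -> T^-L \oL T = bid V.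
Proof. by case/binv_is_binv. Qed.

Lemma bcompVr V W (T : 'L(V, W)) : binvertible T -> T \oL T^-L = bid W.
Proof. by case/binv_is_binv. Qed.

Lemma bcompVKr U V W (T : 'L(V, W)) (S : 'L(V, U)) :
  binvertible T -> S \oL T^-L \oL T = S.
Proof. by move=> Ti; rewrite -bcompA bcompVl// bcomp1r. Qed.

Lemma bcompKr U V W (T : 'L(V, W)) (S : 'L(W, U)) :
  binvertible T -> S \oL T \oL T^-L = S.
Proof. by move=> Ti; rewrite -bcompA bcompVr// bcomp1r. Qed.

Lemma is_binv_eq V W (T : 'L(V, W)) S : is_binv T S -> T^-L = S.
Proof.
move=> TS; have Ti : binvertible T by exists S.
by rewrite -[LHS]bcomp1l -TS.1 -bcompA bcompVr// bcomp1r.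
Qed.

Lemma is_binv_comp U V W (S : 'L(V, W)) (T : 'L(U, V)) S' T' :
  is_binv S S' -> is_binv T T' -> is_binv (S \oL T) (T' \oL S').
Proof.
move=> [S1 S2] [T1 T2]; split.
  by rewrite -bcompA (bcompA S') S1 bcomp1l.
by rewrite -bcompA (bcompA T) T2 bcomp1l.
Qed.

Lemma binvertible_comp U V W (S : 'L(V, W)) (T : 'L(U, V)) :
  binvertible S -> binvertible T -> binvertible (S \oL T).
Proof. by move=> [S' ?] [T' ?]; exists (T' \oL S'); exact: is_binv_comp. Qed.

Lemma is_binv_sym V W (T : 'L(V, W)) S : is_binv T S -> is_binv S T.
Proof. by case. Qed.

(** This is how the left factor P of the affine maps, an operator on K, inherits
    invertibility from the right factor S, an operator on H. *)
Lemma is_binv_swap V W (S : 'L(W, V)) (T : 'L(V, W)) P :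
  is_binv (bid V + S \oL T) P ->
  is_binv (bid W + T \oL S) (bid W - T \oL P \oL S).
Proof.
move=> [P1 P2]; split.
  have swS : S \oL (bid W + T \oL S) = (bid V + S \oL T) \oL S.
    by rewrite bcompDr bcompDl bcomp1r bcomp1l bcompA.
  rewrite bcompBl bcomp1l -(bcompA (T \oL P)) swS bcompA -(bcompA T) P1.
  by rewrite bcomp1r addrK.
have swT : (bid W + T \oL S) \oL T = T \oL (bid V + S \oL T).
  by rewrite bcompDr bcompDl bcomp1r bcomp1l bcompA.
by rewrite bcompBr bcomp1r !bcompA swT -(bcompA T) P2 bcomp1r addrK.
Qed.

(** Instead of summing the Neumann series, the right inverse is obtained as the
    fixed point of S |-> 1 - B S and the left inverse as that of
    T |-> 1 - T B; the norm bound is read off the fixed point equation. *)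
Lemma neumann (V : completeNormedModType R[i]) (B : 'L(V, V)) : `|B| < 1 ->
  exists S, is_binv (bid V + B) S /\ (1 - `|B|) * `|S| <= 1.
Proof.
move=> B1; set q := complex.Re `|B|.
have Bq : `|B| = q%:C%C by exact: normRe.
have q0 : 0 <= q by rewrite -lecR -Bq normr_ge0.
have q1 : q < 1 by rewrite -ltcR -Bq rmorph1.
have fix_ (f : 'L(V, V) -> 'L(V, V)) :
    (forall S T, `|f S - f T| <= q%:C%C * `|S - T|) -> exists S, f S = S.
  move=> fq; have T0 : (setT : set 'L(V, V)) !=set0 by exists 0.
  have [//|S T _ _|S _ fS] := contraction_fixpoint closedT T0 q0 q1 (f := f).
    exact: fq.
  by exists S.
have [S SE] : exists S, bid V - B \oL S = S.
  apply: fix_ => S T; rewrite opprB addrC subrKA -bcompBr distrC -Bq.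
  exact: bcomp_norm.
have [T TE] : exists T, bid V - T \oL B = T.
  apply: fix_ => T T'; rewrite opprB addrC subrKA -bcompBl distrC -Bq mulrC.
  exact: bcomp_norm.
have BS : (bid V + B) \oL S = bid V.
  by rewrite bcompDl bcomp1l -{1}SE subrK.
have TB : T \oL (bid V + B) = bid V.
  by rewrite bcompDr bcomp1r -{1}TE subrK.
have TS : T = S by rewrite -[LHS]bcomp1r -BS bcompA TB bcomp1l.
exists S; split; first by split=> //; rewrite -TS.
rewrite mulrBl mul1r lerBlDr -{1}SE (le_trans (ler_normB _ _))//.
rewrite lerD ?bcomp_norm//.
by apply: blin_norm_le => // x; rewrite mul1r.
Qed.

End Inverses.

(** * Algebra of the linear fractional symmetries *)

Section LinearFractionalAlgebra.
Context {R : realType} {H K : hilbertType R} (C : 'L(K, H)) (D : 'L(H, H)).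
Implicit Types Y Z : 'L(H, K).

Definition lft_den Z := C \oL Z + D.
Local Notation M := lft_den.

(** At Y = Z0 this is the operator X0 of the theorem. *)
Definition lft_jordan Y : 'L(K, H) := (M Y)^-L \oL C.
Local Notation X := lft_jordan.

Local Notation F := (U_formula C D).

Lemma lft_denB Y Z : M Z - M Y = C \oL (Z - Y).
Proof. by rewrite /M bcompBr opprD addrACA subrr addr0. Qed.

Lemma lft_denVden Y Z : binvertible (M Y) ->
  (M Y)^-L \oL M Z = bid H + X Y \oL (Z - Y).
Proof.
by move=> Yi; rewrite /X -bcompA -lft_denB bcompBr bcompVl// addrC subrK.
Qed.

(** C and D have disappeared: the dependence of X Z on Z can be studied through
    X Y and the displacement Z - Y alone. *)
Lemma lft_resolvent Y Z : binvertible (M Y) -> binvertible (M Z) ->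
  X Z = X Y - X Y \oL (Z - Y) \oL X Z.
Proof.
move=> Yi Zi; rewrite {2}/X -(bcompA _ C) -lft_denB bcompBr bcompBl bcompVl//.
by rewrite bcomp1l {3}/X bcompA bcompKr// opprB addrC subrK.
Qed.

(** Written in this way, F Y Z involves C and D only through a quadratic term in
    X Z, which stays in A when X Z is Jordan-closed, and which is negligible to
    first order at Z = Y. *)
Lemma lft_symE Y Z : binvertible (M Z) ->
  F Y Z = Y - (Z - Y) + (Z - Y) \oL X Z \oL (Z - Y).
Proof.
move=> Zi; rewrite /U_formula -!/(M _).
have -> : M Y = M Z - C \oL (Z - Y) by rewrite -lft_denB subKr.
by rewrite bcompBr bcompVKr// opprB addrA addrAC /X !bcompA.
Qed.

(** C (Z - Y) is M Z - M Y, so on denominators F Y becomes m |-> y m^-1 y with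
    y = M Y, the point symmetry at y of the group of invertible operators. *)
Lemma lft_den_sym Y Z : binvertible (M Z) ->
  M (F Y Z) = M Y \oL (M Z)^-L \oL M Y.
Proof.
move=> Zi; rewrite /U_formula -/(M Z) -/(M Y) {1}/M bcompBr addrAC -/(M Y).
by rewrite !bcompA -lft_denB !bcompBl bcompVr// bcomp1l subKr.
Qed.

Lemma lft_den_sym_inv Y Z : binvertible (M Y) -> binvertible (M Z) ->
  is_binv (M (F Y Z)) ((M Y)^-L \oL M Z \oL (M Y)^-L).
Proof.
move=> Yi Zi; rewrite lft_den_sym// -[X in is_binv _ X]bcompA.
apply: is_binv_comp; last exact: binv_is_binv.
by apply: is_binv_comp; [exact: binv_is_binv|exact/is_binv_sym/binv_is_binv].
Qed.

Lemma lft_symK Y Z : binvertible (M Y) -> binvertible (M Z) -> F Y (F Y Z) = Z.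
Proof.
move=> Yi Zi; rewrite {1}/U_formula -!/(M _).
rewrite (is_binv_eq (lft_den_sym_inv Yi Zi)) /U_formula -!/(M _).
set T := Z - Y; set N := (X in Y - X - Y).
rewrite [Y - N - Y]addrC addKr /N !bcompNl opprK !bcompA.
by rewrite bcompVKr// bcompKr// bcompVKr// addrC subrK.
Qed.

Lemma lft_sym_id Y : F Y Y = Y.
Proof. by rewrite /U_formula subrr !bcomp0l subr0. Qed.

(** In this factored form it is visible that the map is affine in Z; its
    expansion, on the other hand, is a sum of terms in which X Y1 is sandwiched
    symmetrically, which is why it leaves A invariant. *)
Definition lft_affine_formula Y1 Y2 Z : 'L(H, K) :=
  Y2 + ((Z - Y1) + (Y2 - Y1) + (Y2 - Y1) \oL X Y1 \oL (Z - Y1)) \oL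
       (bid H + X Y1 \oL (Y2 - Y1)).

(** By lft_den_sym, the inverse of M (F Y1 Z) has M Z as a factor in its middle.
    It cancels the (M Z)^-L contained in F Y1 Z, and only an affine function of
    Z remains. *)
Lemma lft_sym_comp Y1 Y2 Z :
  binvertible (M Y1) -> binvertible (M Y2) -> binvertible (M Z) ->
  F Y2 (F Y1 Z) = lft_affine_formula Y1 Y2 Z.
Proof.
move=> Y1i Y2i Zi; rewrite /lft_affine_formula {1}/U_formula -!/(M _).
rewrite (is_binv_eq (lft_den_sym_inv Y1i Zi)) /U_formula -!/(M _).
rewrite -(lft_denVden Y2 Y1i) !bcompA; congr (_ + _).
rewrite -2!bcompNl; congr (_ \oL _ \oL _).
set E := Y2 - Y1; set T := Z - Y1.
have -> : Y1 - T \oL (M Z)^-L \oL M Y1 - Y2 = - (E + T \oL (M Z)^-L \oL M Y1).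
  by rewrite /E opprD opprB addrAC.
rewrite !bcompNl opprK (bcompDl E) (bcompDl (E \oL _)) bcompKr// bcompVKr//.
by rewrite addrC -bcompA lft_denVden// bcompDr bcomp1r addrA /X !bcompA.
Qed.

End LinearFractionalAlgebra.

(** * Jordan-closed operators *)

Section JordanClosed.
Context {R : realType} {H K : hilbertType R} (A : closedSubspace 'L(H, K)).
Implicit Types (X : 'L(K, H)) (Z W h : 'L(H, K)).

Local Notation "x \inA" := (x \in subspace_mem A) (at level 70).

Definition jordan_closed X := forall Z, Z \inA -> Z \oL X \oL Z \inA.

Section Fixed.
Variables (X : 'L(K, H)) (jX : jordan_closed X).

Lemma jordan_closed_polar Z W :
  Z \inA -> W \inA -> Z \oL X \oL W + W \oL X \oL Z \inA.
Proof.
move=> ZA WA.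
have -> : Z \oL X \oL W + W \oL X \oL Z =
    (Z + W) \oL X \oL (Z + W) - Z \oL X \oL Z - W \oL X \oL W.
  rewrite !bcompDl !bcompDr.
  move: (Z \oL X \oL Z) (W \oL X \oL W) (Z \oL X \oL W) (W \oL X \oL Z).
  move=> a b c d; rewrite addrAC addrA (@addrK 'L(H, K)) -(addrA a).
  by rewrite [a + _]addrC (@addrK 'L(H, K)).
by rewrite !rpredB ?jX ?rpredD.
Qed.

(** In a Jordan algebra with product a o b, the quadratic operator is
    2 a o (a o b) - (a o a) o b up to normalization. *)
Lemma jordan_closed_quad Z W :
  Z \inA -> W \inA -> Z \oL X \oL W \oL X \oL Z \inA.
Proof.
move=> ZA WA; set Q := _ \oL Z.
have : Q + Q \inA.
  have -> : Q + Q =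
      (Z \oL X \oL (Z \oL X \oL W + W \oL X \oL Z) +
       (Z \oL X \oL W + W \oL X \oL Z) \oL X \oL Z) -
      ((Z \oL X \oL Z) \oL X \oL W + W \oL X \oL (Z \oL X \oL Z)).
    rewrite !bcompDr !bcompDl !bcompA -/Q.
    move: (Z \oL X \oL Z \oL X \oL W) (W \oL X \oL Z \oL X \oL Z) => a b.
    by rewrite [Q + b]addrC addrACA [a + b + _]addrC (@addrK 'L(H, K)).
  by rewrite rpredB ?jordan_closed_polar ?jX.
have half (G : lmodType R[i]) (x : G) : 2^-1 *: (x + x) = x.
  by rewrite scalerDr -scalerDl -[RHS]scale1r [in RHS](splitr 1) mul1r.
by move=> /(rpredZ 2^-1); rewrite half.
Qed.

End Fixed.

(** Iterating the two resolvent equations once,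
    W X' W = W X W - W X h X W + W X (h X' h) X W, so it is enough to show that
    h X' h lies in A. This operator solves e = a + h X e X h with a in A; the
    right-hand side is a contraction that preserves the closed set A, so its
    unique fixed point lies in A. *)
Lemma jordan_closed_resolvent X X' h :
  h \inA -> `|X| * `|h| < 1 ->
  X' = X - X \oL h \oL X' -> X' = X - X' \oL h \oL X ->
  jordan_closed X -> jordan_closed X'.
Proof.
move=> hA Xh X'l X'r jX.
have X'E : X' = X - X \oL h \oL X + X \oL h \oL X' \oL h \oL X.
  by rewrite {1}X'l {1}X'r bcompBr opprB addrA addrAC !bcompA.
pose Q s := h \oL X \oL s \oL X \oL h.
have QB s t : Q s - Q t = Q (s - t) by rewrite /Q bcompBr !bcompBl.
pose a := h \oL X \oL h - Q h.
have aA : a \inA by rewrite rpredB ?jX ?jordan_closed_quad.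
pose e := h \oL X' \oL h.
have eE : e = a + Q e.
  by rewrite {1}/e X'E /a /Q /e !(bcompDr, bcompDl, bcompNr, bcompNl, bcompA).
set q := complex.Re ((`|X| * `|h|) ^+ 2).
have q0' : 0 <= (`|X| * `|h|) ^+ 2 by rewrite exprn_ge0// mulr_ge0.
have qE : q%:C%C = (`|X| * `|h|) ^+ 2 by rewrite RRe_real// ger0_real.
have q0 : 0 <= q by rewrite -lecR qE.
have q1 : q < 1 by rewrite -ltcR qE rmorph1 expr_lt1// mulr_ge0.
have Qq s : `|Q s| <= q%:C%C * `|s|.
  rewrite qE (_ : _ * `|s| = `|h| * `|X| * `|s| * `|X| * `|h|); last by ring.
  do 3!rewrite (le_trans (bcomp_norm _ _))// ler_wpM2r//.
  exact: bcomp_norm.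
have A0 : subspace_set A !=set0 by exists h; exact/set_mem.
have fA s : subspace_set A s -> subspace_set A (a + Q s).
  move=> /mem_set sA; suff /set_mem : a + Q s \in subspace_mem A by [].
  by rewrite rpredD// jordan_closed_quad.
have fq s t : subspace_set A s -> subspace_set A t ->
    `|a + Q s - (a + Q t)| <= q%:C%C * `|s - t|.
  by move=> _ _; rewrite opprD addrACA subrr add0r QB.
have [s sA sE] := contraction_fixpoint (@subspace_closed _ _ A) A0 q0 q1 fA fq.
have eA : e \inA.
  suff -> : e = s by exact/mem_set.
  apply/eqP; rewrite -subr_eq0 -normr_le0.
  have es : e - s = Q (e - s).
    by rewrite {1}eE -{1}sE opprD addrACA subrr add0r QB.
  have := Qq (e - s); rewrite -es -subr_le0 -[X in X - _]mul1r -mulrBl.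
  by rewrite pmulr_rle0// subr_gt0 ltcR.
move=> W WA; rewrite X'E.
have -> : W \oL (X - X \oL h \oL X + X \oL h \oL X' \oL h \oL X) \oL W =
    W \oL X \oL W - W \oL X \oL h \oL X \oL W + W \oL X \oL e \oL X \oL W.
  by rewrite /e !(bcompDr, bcompDl, bcompNr, bcompNl, bcompA).
by rewrite rpredD ?rpredB ?jX ?jordan_closed_quad.
Qed.

End JordanClosed.

(** * The symmetries as maps of the subspace *)

Section SubspaceElements.
Context {R : realType} {V : normedModType R[i]} (A : closedSubspace V).
Implicit Types Y Z : A.

Lemma subspace_memP Y : \val Y \in subspace_mem A.
Proof. exact: valP. Qed.

Lemma subspace_valD Y Z : \val (Y + Z) = \val Y + \val Z.
Proof. by []. Qed.

Lemma subspace_valB Y Z : \val (Y - Z) = \val Y - \val Z.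
Proof. by []. Qed.

Lemma subspace_valZD (k : R[i]) Y Z : \val (k *: Y + Z) = k *: \val Y + \val Z.
Proof. by []. Qed.

Lemma subspace_val0 : \val (0 : A) = 0.
Proof. by []. Qed.

Lemma subspace_normE Y : `|Y| = `|\val Y|.
Proof. by []. Qed.

Lemma subspace_val_continuous : continuous (@subspace_val R V A : A -> V).
Proof.
move=> Y; apply/(@cvgrPdist_lt _ _ _ (nbhs Y)) => e e0.
by apply/(@nbhs_ballP _ A); exists e => //= Z; rewrite -ball_normE.
Qed.

Lemma corestrE (f : V -> V) Y :
  f (\val Y) \in subspace_mem A -> \val (corestr f Y) = f (\val Y).
Proof. by move=> fu; rewrite /corestr insubdK. Qed.

End SubspaceElements.

Section Neighbourhoods.
Context {R : realType} {H K : hilbertType R} (A : closedSubspace 'L(H, K)).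
Context (C : 'L(K, H)) (D : 'L(H, H)).
Implicit Types Y Z : A.

Local Notation M := (lft_den C D).
Local Notation X := (lft_jordan C D).

(** The bound on X Z makes the remainder of U_Y uniformly quadratic, and makes
    the smallness condition of jordan_closed_shift symmetric in Y and Z. *)
Lemma lft_den_near (Y : 'L(H, K)) : binvertible (M Y) ->
  \forall Z \near Y, binvertible (M Z) /\ `|X Z| <= 2 * `|X Y|.
Proof.
move=> Yi; near=> Z.
have small : `|X Y \oL (Z - Y)| <= 2^-1.
  rewrite (le_trans (bcomp_norm _ _))//.
  have x1 : 0 < `|X Y| + 1 by rewrite ltr_wpDl.
  rewrite (@le_trans _ _ ((`|X Y| + 1) * `|Z - Y|))//.
    by rewrite ler_wpM2r// lerDl.
  rewrite -ler_pdivlMl// distrC; near: Z; apply: cvgr_dist_le => //.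
have MZ : M Z = M Y \oL (bid H + X Y \oL (Z - Y)).
  by rewrite -lft_denVden// bcompA bcompVr// bcomp1l.
have [|S [S1 Sn]] := @neumann R H (X Y \oL (Z - Y)).
  by rewrite (le_lt_trans small)// invf_lt1// ltr1n.
have MSi : is_binv (M Z) (S \oL (M Y)^-L).
  by rewrite MZ; apply: is_binv_comp => //; exact: binv_is_binv.
split; first by exists (S \oL (M Y)^-L).
rewrite /lft_jordan (is_binv_eq MSi) -bcompA (le_trans (bcomp_norm _ _))//.
rewrite ler_wpM2r//.
have h2 : 2^-1 <= 1 - `|X Y \oL (Z - Y)|.
  rewrite lerBrDr -lerBrDl (le_trans small)//.
  by rewrite [X in X - _](splitr 1) mul1r addrK.
have := le_trans (ler_wpM2r (normr_ge0 S) h2) Sn.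
by rewrite ler_pdivrMl// mulr1.
Unshelve. all: by end_near. Qed.

Lemma lft_domain_near Y : lft_domain C D Y ->
  \forall Z \near Y, lft_domain C D Z /\ `|X (\val Z)| <= 2 * `|X (\val Y)|.
Proof. by move=> /lft_den_near; exact: subspace_val_continuous. Qed.

Lemma lft_domain_open : open (lft_domain C D : set A).
Proof.
by rewrite openE => Y /lft_domain_near; apply: filterS => Z [].
Qed.

Lemma jordan_closed_shift (Y Z : A) : lft_domain C D Y -> lft_domain C D Z ->
  `|X (\val Y)| * `|Z - Y| < 1 ->
  jordan_closed A (X (\val Y)) -> jordan_closed A (X (\val Z)).
Proof.
rewrite subspace_normE subspace_valB => Yi Zi small.
apply: (jordan_closed_resolvent _ small).
- by rewrite rpredB ?subspace_memP.
- exact: lft_resolvent.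
- have {1}-> := lft_resolvent Zi Yi.
  by rewrite -[\val Y - _]opprB bcompNr bcompNl opprK (@addrK 'L(K, H)).
Qed.

(** Both directions are needed: the converse one shows that the set of Z with
    X Z Jordan-closed is relatively closed in the domain. *)
Lemma jordan_closed_near (Y : A) : lft_domain C D Y ->
  \forall Z \near Y, lft_domain C D Z /\
    (jordan_closed A (X (\val Y)) <-> jordan_closed A (X (\val Z))).
Proof.
move=> Yi; near=> Z.
have [Zi Zb] : lft_domain C D Z /\ `|X (\val Z)| <= 2 * `|X (\val Y)|.
  by near: Z; exact: lft_domain_near.
have x1 : 0 < 2 * `|X (\val Y)| + 1 by rewrite ltr_wpDl// mulr_ge0.
have YZ : (2 * `|X (\val Y)| + 1) * `|Y - Z| < 1.
  rewrite -ltr_pdivlMl// mulr1; near: Z; apply: cvgr_dist_lt => //.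
split=> //; split; apply: jordan_closed_shift => //; apply: le_lt_trans YZ.
  by rewrite distrC ler_wpM2r// ler_wpDr// ler_peMl// ler1n.
by rewrite ler_wpM2r// ler_wpDr.
Unshelve. all: by end_near. Qed.

End Neighbourhoods.

Section Maps.
Context {R : realType} {H K : hilbertType R} (A : closedSubspace 'L(H, K)).
Context (C : 'L(K, H)) (D : 'L(H, H)).
Implicit Types Y Z : A.

Local Notation M := (lft_den C D).
Local Notation X := (lft_jordan C D).
Local Notation U := (U_map C D).

(** The points at which all the formulas below stay inside A; by
    component_jordan, it contains the whole component of the theorem. *)
Definition jordan_domain : set A :=
  [set Z | lft_domain C D Z /\ jordan_closed A (X (\val Z))].
Local Notation G := jordan_domain.

Lemma U_mapE Y Z : G Z -> \val (U Y Z) = U_formula C D (\val Y) (\val Z).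
Proof.
move=> [Zi Zj]; rewrite corestrE// lft_symE//.
have := subspace_memP (Z - Y); rewrite subspace_valB => TA.
by rewrite rpredD ?Zj// rpredB ?subspace_memP.
Qed.

Lemma U_mapY Y : G Y -> U Y Y = Y.
Proof. by move=> YG; apply: val_inj; rewrite U_mapE// lft_sym_id. Qed.

Lemma U_map_domain Y Z : lft_domain C D Y -> G Z -> lft_domain C D (U Y Z).
Proof.
move=> Yi ZG; rewrite /lft_domain/= U_mapE//.
by eexists; apply: lft_den_sym_inv; [|case: ZG].
Qed.

Lemma U_mapK Y Z : lft_domain C D Y -> G Z -> G (U Y Z) -> U Y (U Y Z) = Z.
Proof.
move=> Yi ZG UG; apply: val_inj; rewrite !U_mapE//.
by apply: lft_symK => //; case: ZG.
Qed.

Definition lft_affine Y1 Y2 : A -> A :=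
  corestr (lft_affine_formula C D (\val Y1) (\val Y2)).

(** The product expands into terms Z, Z X W + W X Z, Z X Z and Z X W X Z, all of
    which are in A. *)
Lemma lft_affineE Y1 Y2 Z : G Y1 ->
  \val (lft_affine Y1 Y2 Z) =
  lft_affine_formula C D (\val Y1) (\val Y2) (\val Z).
Proof.
move=> [_ Xj]; rewrite corestrE// /lft_affine_formula.
have := subspace_memP (Y2 - Y1); have := subspace_memP (Z - Y1).
rewrite !subspace_valB.
move: (\val Z - \val Y1) (\val Y2 - \val Y1) => T E TA EA.
have -> : (T + E + E \oL X (\val Y1) \oL T) \oL (bid H + X (\val Y1) \oL E) =
    T + E + E \oL X (\val Y1) \oL E +
    (T \oL X (\val Y1) \oL E + E \oL X (\val Y1) \oL T) +
    E \oL X (\val Y1) \oL T \oL X (\val Y1) \oL E.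
  rewrite bcompDr bcomp1r !bcompDl !bcompA.
  have AC (G : zmodType) (t a b c d : G) :
      t + c + (a + b + d) = t + b + (a + c) + d.
    by rewrite !addrA [LHS](ACl (1*4*3*2*5)).
  exact: AC.
rewrite rpredD ?subspace_memP// rpredD ?jordan_closed_quad//.
by rewrite rpredD ?jordan_closed_polar// rpredD ?Xj// rpredD.
Qed.

Lemma lft_affine_comp Y1 Y2 Z :
  G Y1 -> lft_domain C D Y2 -> G Z -> G (U Y1 Z) ->
  U Y2 (U Y1 Z) = lft_affine Y1 Y2 Z.
Proof.
move=> Y1G Y2i ZG UG; apply: val_inj; rewrite lft_affineE// !U_mapE//.
by apply: lft_sym_comp => //; [case: Y1G|case: ZG].
Qed.

(** The right factor of the formula is (M Y1)^-L \oL M Y2, so that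
    S = (M Y2)^-L \oL M Y1; the left one is P = 1 + E X1, whose
    invertibility comes from that of 1 + X1 E. *)
Lemma lft_affine_lft Y1 Y2 : G Y1 -> lft_domain C D Y2 ->
  invertible_affine_lft (lft_affine Y1 Y2).
Proof.
move=> Y1G Y2i; have [Y1i _] := Y1G.
set E := \val Y2 - \val Y1; set X1 := X (\val Y1).
have Mi : is_binv ((M (\val Y2))^-L \oL M (\val Y1)) (bid H + X1 \oL E).
  rewrite -lft_denVden//; apply: is_binv_comp; last exact: binv_is_binv.
  exact/is_binv_sym/binv_is_binv.
have Pi : binvertible (bid K + E \oL X1).
  eexists; apply: is_binv_swap; exact/is_binv_sym/Mi.
set S := _ \oL M (\val Y1) in Mi; set P := bid K + _ in Pi.
exists P, (E - P \oL \val Y1 + \val Y2 \oL S), S; split => //.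
  by eexists; exact: Mi.
move=> Z; rewrite lft_affineE// (is_binv_eq Mi) /lft_affine_formula -/E -/X1.
rewrite [in RHS]addrA [RHS]bcompDl -[X in _ = _ + X]bcompA Mi.2 bcomp1r.
rewrite [RHS]addrC.
suff -> : \val Z - \val Y1 + E + E \oL X1 \oL (\val Z - \val Y1) =
    P \oL \val Z + (E - P \oL \val Y1) by [].
rewrite [RHS]addrCA -bcompBr [P \oL _]bcompDl bcomp1l [RHS]addrA.
by rewrite [E + _]addrC.
Qed.

Lemma invertible_affine_lft_affine (phi : A -> A) :
  invertible_affine_lft phi -> affine_map phi.
Proof.
move=> [P [Q [S [_ _ phiE]]]]; pose L Z := phi Z - phi 0.
have LE Z : \val (L Z) = P \oL \val Z \oL S^-L.
  rewrite subspace_valB !phiE -bcompBl subspace_val0 bcomp0r add0r.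
  by rewrite (@addrK 'L(H, K)).
have linL : linear L.
  move=> k Z Z'; apply: val_inj.
  rewrite subspace_valZD !LE subspace_valZD.
  by rewrite bcompDr bcompZr bcompDl bcompZl.
have Lb : L \in bounded_operator.
  apply: (@linear_bounded_operator _ _ _ _ (`|P| * `|S^-L|)) => // Z.
  rewrite !subspace_normE LE (le_trans (bcomp_norm _ _))// mulrAC.
  by rewrite ler_wpM2r// bcomp_norm.
by exists (BLin Lb), (phi 0) => Z; rewrite /= subrK.
Qed.

Lemma invertible_affine_lft_id : invertible_affine_lft (@id A).
Proof.
exists (bid K), 0, (bid H).
have b1 (V : normedModType R[i]) : is_binv (bid V) (bid V).
  by split; rewrite bcomp1l.
split; [by exists (bid K)|by exists (bid H)|move=> Z].
by rewrite (is_binv_eq (b1 _)) bcomp1l bcomp1r addr0.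
Qed.

Lemma invertible_affine_lft_comp (phi psi : A -> A) :
  invertible_affine_lft phi -> invertible_affine_lft psi ->
  invertible_affine_lft (psi \o phi).
Proof.
move=> [P [Q [S [Pi Si phiE]]]] [P' [Q' [S' [P'i S'i psiE]]]].
exists (P' \oL P), (P' \oL Q + Q' \oL S), (S' \oL S); split.
- exact: binvertible_comp.
- exact: binvertible_comp.
- move=> Z /=; rewrite psiE phiE.
  rewrite (is_binv_eq (is_binv_comp (binv_is_binv S'i) (binv_is_binv Si))).
  by rewrite !(bcompDl, bcompDr, bcompA) bcompKr// addrA.
Qed.

Lemma jordan_domain_near Y : G Y -> \forall Z \near Y, G Z.
Proof.
move=> [Yi Yj]; apply: filterS (jordan_closed_near Yi) => Z [Zi YZ].
by split=> //; exact/YZ.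
Qed.

Lemma U_map_shift Y h : G (Y + h) ->
  \val (U Y (Y + h) - Y + h) = \val h \oL X (\val (Y + h)) \oL \val h.
Proof.
move=> YhG; rewrite subspace_valD subspace_valB U_mapE// lft_symE; last first.
  by case: YhG.
have -> : \val (Y + h) - \val Y = \val h.
  by rewrite subspace_valD addrC addKr.
have AC (V : zmodType) (y k r : V) : y - k + r - y + k = r.
  by rewrite (ACl (1*4*(2*5)*3))/= subrr add0r addNr add0r.
exact: AC.
Qed.

(** The remainder h X(Y + h) h of U_map_shift is quadratic in h because X is
    bounded near Y. *)
Lemma U_map_differential Y : G Y ->
  differentiable (U Y) Y /\ forall h, 'd (U Y) Y h = - h.
Proof.
move=> YG; have [Yi Yj] := YG.
have [||dU dE] := @quadratic_remainder_diff R A A (U Y) Y (- bid A)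
  (2 * `|X (\val Y)|).
- by rewrite mulr_ge0.
- have : \forall Z \near Y, G Z /\ `|X (\val Z)| <= 2 * `|X (\val Y)|.
    near=> Z; split; first by near: Z; exact: jordan_domain_near.
    by near: Z; apply: filterS (lft_domain_near Yi) => ? [].
  rewrite (near_shift 0) subr0; apply: filterS => h /=.
  rewrite addrC => -[ZG Zb].
  have -> : `|U Y (Y + h) - U Y Y - (- bid A) h| =
      `|\val h \oL X (\val (Y + h)) \oL \val h|.
    rewrite (_ : (- bid A) h = - h)// opprK U_mapY//.
    by rewrite subspace_normE U_map_shift.
  rewrite (le_trans (bcomp_norm _ _))// expr2 mulrA ler_wpM2r//.
  rewrite (le_trans (bcomp_norm _ _))// mulrC ler_wpM2r//.
  by rewrite addrC.
- by split=> // h; rewrite dE.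
Unshelve. all: by end_near. Qed.

(** Away from its centre, U Y is locally the product of the affine map
    U Y \o U Z with U Z, whose centre is Z. *)
Lemma U_map_differentiable Y Z : lft_domain C D Y -> G Z ->
  differentiable (U Y) Z.
Proof.
move=> Yi ZG; have [Zi _] := ZG; have [dU _] := U_map_differential ZG.
apply: (@near_eq_differentiable _ _ _ _ (lft_affine Z Y \o U Z)); last first.
  apply: differentiable_comp => //; apply: affine_map_differentiable.
  exact/invertible_affine_lft_affine/lft_affine_lft.
have UG : \forall V \near Z, G (U Z V).
  apply: (differentiable_continuous dU); rewrite U_mapY//.
  exact: jordan_domain_near.
near=> V; have VG : G V by near: V; exact: jordan_domain_near.
have UVG : G (U Z V) by near: V.
by rewrite /= -lft_affine_comp// U_mapK.
Unshelve. all: by end_near. Qed.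

End Maps.

(** * Local transitivity *)

Section MidpointEquation.
Context {R : realType} {H K : hilbertType R} (A : closedSubspace 'L(H, K)).

(** The equation is the fixed point equation of V |-> (E - V X V) / 2, which
    contracts the ball of radius r of A by a factor 1/2. *)
Lemma midpoint_equation (X : 'L(K, H)) (E : 'L(H, K)) (r : R[i]) :
  jordan_closed A X -> 0 <= r -> `|X| * r <= 2^-1 ->
  E \in subspace_mem A -> `|E| <= r ->
  exists V, [/\ V \in subspace_mem A, `|V| <= r & V + V + V \oL X \oL V = E].
Proof.
move=> jX r0 Xr EA Er.
pose S := subspace_set A `&` [set V | `|V| <= r].
pose f (V : 'L(H, K)) := 2^-1 *: (E - V \oL X \oL V).
have half0 : 0 <= (2^-1 : R[i]) by rewrite invr_ge0.
have halfE : (2^-1 : R)%:C%C = 2^-1 by rewrite fmorphV rmorph_nat.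
have bnd (P Q : 'L(H, K)) : `|P| <= r -> `|P \oL X \oL Q| <= 2^-1 * `|Q|.
  move=> Pr; rewrite (le_trans (bcomp_norm _ _))// ler_wpM2r//.
  by rewrite (le_trans (bcomp_norm _ _))// (le_trans _ Xr)// mulrC ler_wpM2l.
have bnd' (P Q : 'L(H, K)) : `|P| <= r -> `|Q \oL X \oL P| <= 2^-1 * `|Q|.
  move=> Pr; rewrite -bcompA (le_trans (bcomp_norm _ _))// mulrC ler_wpM2r//.
  by rewrite (le_trans (bcomp_norm _ _))// (le_trans _ Xr)// ler_wpM2l.
have clS : closed S.
  by apply: closedI; [exact: subspace_closed|exact: closed_norm_le].
have S0 : S !=set0 by exists E; split=> //; exact/set_mem.
have half1 : (2^-1 : R) < 1 by rewrite invf_lt1// ltr1n.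
have fS V : S V -> S (f V).
  move=> [/mem_set VA /= Vr]; split.
    suff /set_mem : f V \in subspace_mem A by [].
    by rewrite rpredZ// rpredB// jX.
  rewrite /= normrZ ger0_norm// -[leRHS]mul1r [in leRHS](splitr 1) mul1r mulrDl.
  rewrite (le_trans (ler_wpM2l half0 (ler_normB _ _)))// mulrDr.
  rewrite lerD ?ler_wpM2l// (le_trans (bnd _ _ Vr))//.
  rewrite (le_trans (ler_wpM2l half0 Vr))// ler_piMl//.
  by rewrite -halfE lecR ltW.
have fq V W : S V -> S W -> `|f V - f W| <= (2^-1 : R)%:C%C * `|V - W|.
  move=> [_ /= Vr] [_ /= Wr]; rewrite halfE /f -scalerBr normrZ ger0_norm//.
  rewrite ler_wpM2l//.
  have -> : E - V \oL X \oL V - (E - W \oL X \oL W) =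
      W \oL X \oL (W - V) + (W - V) \oL X \oL V.
    rewrite opprB addrC subrKA bcompBr !bcompBl.
    by rewrite subrKA.
  rewrite distrC (le_trans (ler_normD _ _))//.
  rewrite -[leRHS]mul1r [in leRHS](splitr 1) mul1r mulrDl lerD//.
    exact: bnd.
  exact: bnd'.
have h0 : 0 <= (2^-1 : R) by rewrite invr_ge0.
have [V [/mem_set VA /= Vr] fV] := contraction_fixpoint clS S0 h0 half1 fS fq.
exists V; split=> //.
have dbl (G : lmodType R[i]) (x : G) : 2^-1 *: x + 2^-1 *: x = x.
  by rewrite -scalerDl -[RHS]scale1r [in RHS](splitr 1) mul1r.
have -> : V + V = E - V \oL X \oL V by rewrite -{1 2}fV dbl.
by rewrite subrK.
Qed.

End MidpointEquation.

(** * The connected component *)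

Section Component.
Context {R : realType} {H K : hilbertType R} (A : closedSubspace 'L(H, K)).
Context (C : 'L(K, H)) (D : 'L(H, H)) (Z0 : A).
Context (invZ0 : binvertible (C \oL \val Z0 + D)).
Context (jordanZ0 : jordan_closed A ((C \oL \val Z0 + D)^-L \oL C)).
Implicit Types Y Z : A.

Local Notation M := (lft_den C D).
Local Notation X := (lft_jordan C D).
Local Notation U := (U_map C D).
Local Notation Dom := (connected_component (lft_domain C D) Z0).

Lemma component_center : Dom Z0.
Proof. exact: connected_component_refl. Qed.

Lemma component_open : open Dom.
Proof. exact/connected_component_open/lft_domain_open. Qed.

(** The hypothesis at Z0 propagates to the whole component. *)
Lemma component_jordan Y : Dom Y -> jordan_domain C D Y.
Proof.
move=> YD; split; first exact: connected_component_sub YD.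
pose P Z := jordan_closed A (X (\val Z)).
apply: (@connected_locally_const _ Dom P Z0 _ _ _ _ Y YD) => // [||Z ZD].
- exact: component_connected.
- exact: component_center.
have := jordan_closed_near (connected_component_sub ZD).
by apply: filterS => V [].
Qed.

(** The image of the component under U Y is connected, consists of points of
    lft_domain, and contains the fixed point Y. *)
Lemma component_U_map Y Z : Dom Y -> Dom Z -> Dom (U Y Z).
Proof.
move=> YD ZD; have [Yi _] := component_jordan YD.
rewrite (same_connected_component YD).
apply: (@connected_component_max _ _ (U Y @` Dom)); last by exists Z.
- by exists Y => //; rewrite U_mapY//; exact: component_jordan.
- by move=> _ [V VD <-]; apply: U_map_domain => //; exact: component_jordan.
- apply: connected_continuous_connected; first exact: component_connected.
  apply: continuous_in_subspaceT => V /[!inE] VD.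
  apply: differentiable_continuous; apply: U_map_differentiable => //.
  exact: component_jordan.
Qed.

Lemma component_U_mapK Y Z : Dom Y -> Dom Z -> U Y (U Y Z) = Z.
Proof.
move=> YD ZD; have [Yi _] := component_jordan YD.
by apply: U_mapK => //; apply: component_jordan => //; exact: component_U_map.
Qed.

Lemma component_symmetry Y : Dom Y -> symmetry_at Dom Y (U Y).
Proof.
move=> YD; have YG := component_jordan YD; split.
- apply: involution_biholomorphic.
  + split; first exact: component_open.
    by move=> Z /component_jordan; apply: U_map_differentiable; case: YG.
  + by move=> Z; exact: component_U_map.
  + by move=> Z /[!inE]; exact: component_U_mapK.
- by move=> Z /[!inE]; exact: component_U_mapK.
- exact: U_mapY.
- by have [] := U_map_differential YG.
Qed.

(** U Y Z = W says that Y is a midpoint of Z and W; with Y = Z + V it becomes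
    2 V + V X(Z) V = W - Z. *)
Lemma component_midpoint Z : Dom Z ->
  \forall W \near Z, exists2 Y, Dom Y & U Y Z = W.
Proof.
move=> ZD; have ZG := component_jordan ZD; have [Zi Zj] := ZG.
have : nbhs Z Dom by apply: open_nbhs_nbhs; split=> //; exact: component_open.
move=> /nbhs_ballP[e /= e0 eD].
set X0 := X (\val Z) in Zj.
(* The radius must satisfy r < e, for Y to stay in the ball around Z, and
   |X0| r <= 1/2, for the contraction. *)
pose d := (1 + e) * (2 * (`|X0| + 1)); pose r := e / d.
have d0 : 0 < d by rewrite !mulr_gt0// ?addr_gt0// ltr_wpDl.
have r0 : 0 < r by rewrite divr_gt0.
have re : r < e.
  rewrite ltr_pdivrMr// ltr_pMr// /d -[ltLHS]mul1r ltr_pM//.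
    by rewrite ltrDl.
  by rewrite mulrDr mulr1 (@lt_le_trans _ _ 2)// ?ltr1n// lerDr mulr_ge0.
have Xr : `|X0| * r <= 2^-1.
  rewrite /r /d mulrA ler_pdivrMr// (mulrCA (1 + e)) mulKf ?pnatr_eq0//.
  by rewrite mulrC ler_pM// ?(ltW e0)// ?lerDl// ?lerDr.
apply/nbhs_ballP; exists r => //= W; rewrite -ball_normE/= distrC => ZW.
have WZA : \val (W - Z) \in subspace_mem A by exact: subspace_memP.
have WZr : `|\val (W - Z)| <= r by rewrite -subspace_normE ltW.
have [V [VA Vr VE]] := midpoint_equation Zj (ltW r0) Xr WZA WZr.
pose Y : A := Z + SubspaceElt VA.
have YZ : \val Z - \val Y = - V.
  by rewrite subspace_valD opprD addrA subrr sub0r.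
exists Y.
  apply: eD; rewrite -ball_normE/= subspace_normE subspace_valB YZ normrN.
  exact: le_lt_trans Vr re.
apply: val_inj; rewrite U_mapE// lft_symE// YZ !bcompNl bcompNr !opprK.
by rewrite subspace_valD -!addrA [V + _]addrA VE subspace_valB addrC subrK.
Qed.

(** The maps phi are only required to agree with products of symmetries on the
    component: outside lft_domain the maps U V have no meaning, while phi is
    affine everywhere. *)
Definition component_reachable Y (W : A) := exists phi : A -> A,
  [/\ invertible_affine_lft phi, biholomorphic Dom Dom phi, phi Y = W &
      exists Ys : seq A, (forall V, V \in Ys -> Dom V) /\
        forall V, Dom V -> phi V = foldr U V Ys].

Lemma reachable_refl Y : component_reachable Y Y.
Proof.
exists id; split=> //; first exact: invertible_affine_lft_id.
  apply: involution_biholomorphic => //; split; first exact: component_open.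
  move=> V _; apply/affine_map_differentiable/invertible_affine_lft_affine.
  exact: invertible_affine_lft_id.
by exists [::].
Qed.

Lemma foldr_component Z (Ys : seq A) : (forall V, V \in Ys -> Dom V) -> Dom Z ->
  Dom (foldr U Z Ys).
Proof.
move=> YsD ZD; elim: Ys YsD => //= Y Ys IH YsD.
apply: component_U_map; first by apply: YsD; rewrite mem_head.
by apply: IH => V VYs; apply: YsD; rewrite in_cons VYs orbT.
Qed.

(** Symmetries are added in pairs, since only even products are affine. *)
Lemma reachable_step Y W Y1 Y2 : Dom Y1 -> Dom Y2 -> Dom Y ->
  component_reachable Y W -> component_reachable Y (U Y2 (U Y1 W)).
Proof.
move=> Y1D Y2D YD [phi [phiL phiB <- [Ys [YsD phiE]]]].
have Y1G := component_jordan Y1D; have [Y2i _] := component_jordan Y2D.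
have affE V : Dom V -> lft_affine C D Y1 Y2 V = U Y2 (U Y1 V).
  move=> VD; rewrite -lft_affine_comp//; first exact: component_jordan.
  by apply: component_jordan; exact: component_U_map.
have phiD V : Dom V -> Dom (phi V).
  by move=> VD; rewrite phiE//; exact: foldr_component.
exists (lft_affine C D Y1 Y2 \o phi); split.
- by apply: invertible_affine_lft_comp => //; exact: lft_affine_lft.
- apply: biholomorphic_comp => //.
  apply: (@biholomorphic_eq _ _ _ _ (U Y2 \o U Y1)).
    by move=> V /[!inE]; exact: affE.
  apply: biholomorphic_comp.
    by case: (component_symmetry Y1D).
  by case: (component_symmetry Y2D).
- by rewrite /= affE//; exact: phiD.
- exists [:: Y2, Y1 & Ys]; split.
    by move=> V; rewrite !in_cons => /or3P[/eqP->|/eqP->|/YsD].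
  by move=> V VD /=; rewrite affE ?phiE//; exact: foldr_component.
Qed.

(** If W = U_Z(V) then W = U_Z(U_V(V)) and V = U_V(U_Z(W)), so V and the
    points W near it are reachable simultaneously. *)
Lemma component_transitive Y W : Dom Y -> Dom W -> component_reachable Y W.
Proof.
move=> YD.
apply: (@connected_locally_const _ Dom (component_reachable Y) Y _ YD).
- exact: component_connected.
- exact: reachable_refl.
move=> V VD.
apply: filterS (component_midpoint VD) => V' [Z ZD <-] V'D.
split=> [|/(reachable_step ZD VD YD)].
  by move=> /(reachable_step VD ZD YD); rewrite (U_mapY (component_jordan VD)).
by rewrite component_U_mapK// U_mapY//; exact: component_jordan.
Qed.

End Component.

Theorem theorem1 (R : realType) (H K : hilbertType R)
    (A : closedSubspace 'L(H, K)) (C : 'L(K, H)) (D : 'L(H, H)) (Z0 : A)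
    (invZ0 : binvertible (C \oL \val Z0 + D)) :
  let X0 := (C \oL \val Z0 + D)^-L \oL C in
  (forall Z : A, \val Z \oL X0 \oL \val Z \in subspace_set A) ->
  let Dom : set A := connected_component (lft_domain C D) Z0 in
  [/\ symmetric_domain Dom /\ affinely_homogeneous Dom,
      forall Y : A, Dom Y ->
        (forall Z : A, Dom Z ->
           \val (U_map C D Y Z) = U_formula C D (\val Y) (\val Z)) /\
        symmetry_at Dom Y (U_map C D Y) &
      forall W0 : A, Dom W0 -> exists phi : A -> A,
        [/\ invertible_affine_lft phi, biholomorphic Dom Dom phi, phi Z0 = W0 &
            exists Ys : seq A, (forall Y, Y \in Ys -> Dom Y) /\
              forall Z, Dom Z -> phi Z = foldr (U_map C D) Z Ys]].
Proof.
move=> X0 AX0 Dom.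
have jX0 : jordan_closed A X0.
  by move=> Z ZA; exact: (AX0 (SubspaceElt ZA)).
have Z0D := component_center invZ0; split.
- split; last first.
    move=> Y W YD WD.
    have [phi [phiL phiB phiY _]] := component_transitive invZ0 jX0 YD WD.
    by exists phi; split=> //; exact: invertible_affine_lft_affine.
  split; last by move=> Y YD; exists (U_map C D Y); exact: component_symmetry.
  split; [by exists Z0 | exact: component_open | exact: component_connected].
- move=> Y YD; split; last exact: component_symmetry.
  by move=> Z ZD; apply: U_mapE; exact: component_jordan ZD.
- by move=> W0 W0D; exact: component_transitive.
Qed.
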